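(* Let $T_1$ and $T_2$ be trees (on the same vertex set) where $T_2$ is obtained from $T_1$ by an edge exchange. Then $$\dim(T_1)-2\le \dim(T_2)\le \dim(T_1)+2.$$ If the upper bound is attained (i.e. $\dim(T_2)=\dim(T_1)+2$), then there is a metric basis for $T_2$ that contains a metric basis for $T_1$, and if the lower bound is attained (i.e. $\dim(T_2)=\dim(T_1)-2$), then there is a metric basis for $T_1$ that contains a metric basis for $T_2$. Moreover, these bounds are sharp: there exist such pairs $(T_1,T_2)$ attaining the upper bound, and there exist such pairs attaining the lower bound.
   Context: All graphs are finite and simple. For a connected graph $G=(V,E)$, $d_G(x,y)$ denotes the length of a shortest path between $x$ and $y$ in $G$. A vertex $v$ resolves two vertices $x,y$ if $d_G(v,x)\ne d_G(v,y)$. A set $S\subseteq V$ is a metric generator for $G$ if every pair of distinct vertices of $G$ is resolved by some element of $S$; a metric basis of $G$ is a metric generator of minimum cardinality, and this cardinality is the metric dimension $\dim(G)$. A tree $T_2$ is obtained from a tree $T_1$ by an edge exchange if there is an edge $e_1$ (joining two vertices of $T_1$) not in $T_1$ and an edge $f_1$ in $T_1$ such that $T_2=T_1+e_1-f_1$, i.e. $T_2$ is obtained by adding $e_1$ and deleting $f_1$. *)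

(* Defs.v *)
From mathcomp Require Import all_boot.

Set Implicit Arguments.
Unset Strict Implicit.
Unset Printing Implicit Defensive.

(* A graph on the vertex set T is given by its adjacency relation. *)

Definition simple_graph (T : finType) (e : rel T) : Prop :=
  symmetric e /\ irreflexive e.

Definition connected_graph (T : finType) (e : rel T) : Prop :=
  0 < #|T| /\ forall x y : T, connect e x y.

(* The bound on the size excludes the closed walks x, y, x. *)
Definition acyclic_graph (T : finType) (e : rel T) : Prop :=
  forall c : seq T, 2 < size c -> ~ ucycle e c.

Definition tree (T : finType) (e : rel T) : Prop :=
  [/\ simple_graph e, connected_graph e & acyclic_graph e].

Definition walk_of_length (T : finType) (e : rel T) (x y : T) (n : nat) : bool :=
  [exists p : n.-tuple T, path e x p && (last x p == y)].

(* If x and y are connected, a shortest path has length less than #|T|, so this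
   is the least n with walk_of_length e x y n (see gdistP); otherwise the value
   is #|T|. *)
Definition gdist (T : finType) (e : rel T) (x y : T) : nat :=
  find (walk_of_length e x y) (iota 0 #|T|).

Lemma walk_of_lengthP (T : finType) (e : rel T) (x y : T) (n : nat) :
  reflect (exists p : seq T, [/\ path e x p, last x p = y & size p = n])
          (walk_of_length e x y n).
Proof.
apply: (iffP existsP) => [[p /andP[ep /eqP lp]]|[p [ep lp /eqP sp]]].
  by exists p; rewrite size_tuple.
by exists (Tuple sp); rewrite ep lp eqxx.
Qed.

Lemma gdistP (T : finType) (e : rel T) (x y : T) : connect e x y ->
  (exists p : seq T, [/\ path e x p, last x p = y & size p = gdist e x y]) /\
  (forall p : seq T, path e x p -> last x p = y -> gdist e x y <= size p).
Proof.
case/connectP=> p0 + ->; case/shortenP=> p ep up _.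
have sp : size p < #|T| by rewrite -[_.+1]/(size (x :: p)) -(card_uniqP up) max_card.
have hw : has (walk_of_length e x (last x p)) (iota 0 #|T|).
  apply/hasP; exists (size p); first by rewrite mem_iota.
  by apply/walk_of_lengthP; exists p.
have := hw; rewrite has_find size_iota -/(gdist _ _ _) => dT.
split.
  have := nth_find 0 hw; rewrite -/(gdist e x (last x p)) nth_iota // add0n.
  by move/walk_of_lengthP.
move=> q eq lq; rewrite leqNgt; apply/negP => lt_qd.
have := before_find 0 lt_qd; rewrite nth_iota ?add0n; last exact: ltn_trans dT.
by move/negbT/negP; apply; apply/walk_of_lengthP; exists q.
Qed.

Definition resolves (T : finType) (e : rel T) (v x y : T) : bool :=
  gdist e v x != gdist e v y.

Definition metric_generator (T : finType) (e : rel T) (S : {set T}) : bool :=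
  [forall x, forall y, (x != y) ==> [exists v in S, resolves e v x y]].

Lemma metric_generatorT (T : finType) (e : rel T) : metric_generator e [set: T].
Proof.
have d0 x y : x != y -> gdist e x y != gdist e x x.
  move=> nxy; have T0 : 0 < #|T| by apply/card_gt0P; exists x.
  rewrite /gdist -(prednK T0) /=.
  have -> : walk_of_length e x x 0 by apply/walk_of_lengthP; exists [::].
  case: ifP => // /walk_of_lengthP [p [_ lp /size0nil p0]].
  by rewrite -lp p0 /= eqxx in nxy.
apply/forallP => x; apply/forallP => y; apply/implyP => nxy.
apply/exists_inP; exists x; first by rewrite inE.
by rewrite /resolves eq_sym d0.
Qed.

(* The minimum is over a nonempty family: see metric_generatorT. *)
Definition metric_dim (T : finType) (e : rel T) : nat :=
  #|[arg min_(S < [set: T] | metric_generator e S) #|S| ]|.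

Definition metric_basis (T : finType) (e : rel T) (S : {set T}) : bool :=
  metric_generator e S && (#|S| == metric_dim e).

Lemma metric_basisP (T : finType) (e : rel T) (S : {set T}) :
  reflect (metric_generator e S /\
           forall S' : {set T}, metric_generator e S' -> #|S| <= #|S'|)
          (metric_basis e S).
Proof.
rewrite /metric_basis /metric_dim.
case: arg_minnP => [|M gM minM]; first exact: metric_generatorT.
apply: (iffP andP) => [[gS /eqP cS]|[gS minS]]; split=> //.
  by move=> S' /minM; rewrite cS.
by rewrite eqn_leq minS //= minM.
Qed.

(* The edges e1 = ab and f1 = cd are unordered pairs of vertices. *)
Definition edge_exchange (T : finType) (t1 t2 : rel T) : Prop :=
  exists a b c d : T,
    [/\ a != b, ~~ t1 a b, t1 c d &
        forall x y : T,
          t2 x y = (t1 x y || ([set x; y] == [set a; b]))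
                   && ([set x; y] != [set c; d])].

(* Main.v *)
Require Import Defs.
From mathcomp Require Import all_boot.

Set Implicit Arguments.
Unset Strict Implicit.
Unset Printing Implicit Defensive.

(** Deleting the edge cd from T1 leaves a forest F with two components, A
    containing c and B containing d, and T2 reconnects F by an edge ab with,
    say, a in A and b in B.  The whole upper bound comes from one fact: if S
    resolves T1, then S together with c and d resolves T2
    ([generator_bridge_exchange]).  Indeed let x and y be at the same distance
    in T2 from every vertex of S, from c and from d.

    - If x and y both lie in A, distances inside A are the same in both trees,
      and a vertex s of B sees x in T1 at distance d(s,d) + 1 + d(c,x).  As c
      does not separate x from y, no s in S separates them in T1 either, so
      x = y.  The case of B is the same.
    - If x lies in A and y in B, then d(c,x) = d(c,a) + 1 + d(b,y) and the
      triangle inequality give d(b,y) < d(a,x); symmetrically the vertex d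
      gives d(a,x) < d(b,y), a contradiction.

    Hence dim(T2) <= dim(T1) + 2, and when equality holds, adding c and d to
    any metric basis of T1 yields a metric basis of T2.  Edge exchanges between
    trees can be reversed, which gives the lower bound.  Acyclicity only enters
    to ensure that cd and ab are bridges.

    For sharpness, T1 has two hubs, each with two pendant leaves, joined by a
    path of length three through two ports; exchanging the edge between the
    ports for an edge between the hubs gives T2, in which each hub has three
    pendant leaves.  One leaf of each hub resolves T1, but pendant leaves of
    the same hub are twins, so a metric generator of T2 omits at most one leaf
    of each hub and has at least four elements. *)

(** * Distances *)

Section Distance.

Variables (T : finType) (e : rel T).

Lemma gdist_le_size x p : path e x p -> gdist e x (last x p) <= size p.
Proof.
move=> ep; have cx : connect e x (last x p) by apply/connectP; exists p.
by have [_ ->] := gdistP cx.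
Qed.

Lemma gdist_triangle x y z :
  connect e x y -> connect e y z -> gdist e x z <= gdist e x y + gdist e y z.
Proof.
move=> /gdistP[[p [ep lp <-]] _] /gdistP[[q [eq lq <-]] _].
rewrite -size_cat -lq -lp -last_cat; apply: gdist_le_size.
by rewrite cat_path ep lp.
Qed.

Lemma gdist_step x y z :
  connect e x y -> e y z -> gdist e x z <= (gdist e x y).+1.
Proof.
move=> /gdistP[[p [ep lp <-]] _] eyz.
rewrite -(last_rcons x p z) -(size_rcons p z); apply: gdist_le_size.
by rewrite rcons_path ep lp.
Qed.

Lemma gdistxx x : gdist e x x = 0.
Proof. by apply/eqP; rewrite -leqn0; apply: (@gdist_le_size x [::]). Qed.

Lemma gdist_eq0 x y : connect e x y -> gdist e x y = 0 -> y = x.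
Proof. by case/gdistP=> [[p [_ <- <-]] _] /size0nil ->. Qed.

Lemma gdist_pred x y : connect e x y -> 0 < gdist e x y ->
  exists z, [/\ connect e x z, e z y & gdist e x z < gdist e x y].
Proof.
case/gdistP=> [[p [ep lp <-]] _]; case/lastP: p ep lp => // p z.
rewrite rcons_path last_rcons => /andP[ep ez] <- _.
exists (last x p); split=> //; first by apply/connectP; exists p.
by rewrite size_rcons ltnS gdist_le_size.
Qed.

(** Distances from [v] are recognized locally: a function that vanishes only
    at [v], grows by at most one along edges and decreases along some edge
    unless it vanishes is the distance from [v]. *)
Lemma gdist_unique v (f : T -> nat) :
    (forall y, (f y == 0) = (y == v)) ->
    (forall y z, e y z -> f z <= (f y).+1) ->
    (forall y, 0 < f y -> exists2 z, e z y & f z < f y) ->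
  forall y, gdist e v y = f y.
Proof.
move=> f0 fS fpred.
have walk y : exists p, [/\ path e v p, last v p = y & size p <= f y].
  have [n] := ubnP (f y); elim: n y => // n IHn y lt_fy.
  have [/eqP|/[dup] fy /fpred[z ezy lt_fz]] := posnP (f y).
    by rewrite f0 => /eqP->; exists [::].
  have [|p [ep lp sp]] := IHn z; first exact: leq_trans lt_fz lt_fy.
  exists (rcons p y); rewrite rcons_path last_rcons size_rcons ep lp ezy.
  by split=> //; apply: leq_ltn_trans sp lt_fz.
have grow x p : path e x p -> f (last x p) <= f x + size p.
  elim: p x => [|z p IHp] x /=; first by rewrite addn0.
  case/andP=> exz /IHp le_f; apply: leq_trans le_f _.
  by rewrite addnS -addSn leq_add2r fS.
move=> y; have [p [ep lp sp]] := walk y; apply/eqP; rewrite eqn_leq; apply/andP.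
split; first by apply: leq_trans sp; rewrite -lp gdist_le_size.
have /gdistP[[q [eq lq <-]] _] : connect e v y by apply/connectP; exists p.
have := grow _ _ eq; rewrite lq => /leq_trans; apply.
by have /eqP-> : f v == 0 by rewrite f0.
Qed.

Lemma gdist_twins v x y :
    (forall z, e z x = e z y) -> v != x -> v != y ->
  gdist e v x = gdist e v y.
Proof.
move=> exy; rewrite /gdist => nvx nvy; apply: eq_find => n.
(* A walk to one twin becomes a walk to the other by changing its last
   vertex; it has a last edge because v is neither of them. *)
have sub u w : (forall z, e z u = e z w) -> v != u ->
    walk_of_length e v u n -> walk_of_length e v w n.
  move=> euw nvu /walk_of_lengthP[p]; case/lastP: p => [|p z] [].
    by move=> _ /eqP /=; rewrite (negPf nvu).
  rewrite rcons_path last_rcons => /andP[ep ez] zu sp; apply/walk_of_lengthP.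
  exists (rcons p w); rewrite last_rcons size_rcons -sp size_rcons.
  by rewrite rcons_path ep -euw -zu ez.
by apply/idP/idP; apply: sub.
Qed.

Lemma generator_twins (S : {set T}) x y :
    (forall z, e z x = e z y) -> x != y -> metric_generator e S ->
  (x \in S) || (y \in S).
Proof.
move=> exy nxy /forallP/(_ x)/forallP/(_ y); rewrite nxy /=.
case/exists_inP=> v vS; apply: contraR; rewrite negb_or => /andP[xS yS].
by apply/eqP/gdist_twins => //; [move: xS | move: yS]; apply: contraNneq => <-.
Qed.

End Distance.

(** * Exchanging a bridge *)

Lemma eq_set2 (T : finType) (x y a b : T) :
  ([set x; y] == [set a; b]) =
  (x == a) && (y == b) || (x == b) && (y == a).
Proof.
apply/eqP/orP=> [E | [] /andP[/eqP-> /eqP->] //]; last exact: setUC.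
have: x \in [set a; b] by rewrite -E set21.
have: y \in [set a; b] by rewrite -E set22.
have: a \in [set x; y] by rewrite E set21.
have: b \in [set x; y] by rewrite E set22.
rewrite !inE.
by do 4![case/orP=> /eqP ?]; subst; rewrite ?eqxx; auto.
Qed.

Section Bridge.

Variables (T : finType) (F G : rel T) (a b : T).
Hypothesis symF : symmetric F.
Hypothesis GE : forall x y, G x y = F x y || ([set x; y] == [set a; b]).
Hypothesis nab : ~~ connect F a b.
Hypothesis Fab : forall x, connect F a x || connect F b x.

Let symFc : connect_sym F := sym_connect_sym symF.

(** A shortest path leaves the component of [a] at most once, through the
    bridge.  No surgery on paths is needed: the right-hand side passes the
    local test of [gdist_unique]. *)
Lemma gdist_bridge x y : connect F a x ->
  gdist G x y = if connect F x y then gdist F x y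
                else gdist F x a + (gdist F b y).+1.
Proof.
move=> ax; have xa : connect F x a by rewrite symFc.
have conn_x z : connect F x z = connect F a z by rewrite (same_connect symFc ax).
have xb : connect F x b = false by rewrite conn_x (negPf nab).
have side z : connect F x z = false -> connect F b z.
  by rewrite conn_x => az; have := Fab z; rewrite az.
move: y; apply: gdist_unique => [y|y z|y].
- case: ifP => [xy|xy].
    apply/eqP/eqP => [|->]; [exact: gdist_eq0 | exact: gdistxx].
  by rewrite addnS; apply/esym/eqP => yx; rewrite yx connect0 in xy.
- rewrite GE => /orP[Fyz|].
    rewrite -(same_connect_r symFc (connect1 Fyz)).
    case: ifP => [|/side] byz; first exact: gdist_step.
    by rewrite -addnS leq_add2l ltnS gdist_step.
  rewrite eq_set2 => /orP[] /andP[/eqP-> /eqP->]; rewrite xa xb gdistxx addn1 //.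
  by do 2!apply: leqW.
- case: ifP => [xy|xy _].
    case/(gdist_pred xy)=> z [xz Fzy lt_zy].
    by exists z; rewrite ?GE ?Fzy ?xz.
  have [/(gdist_eq0 (side _ xy))->|] := posnP (gdist F b y).
    by exists a; rewrite ?xa ?gdistxx ?addn1 // GE eqxx orbT.
  case/(gdist_pred (side _ xy))=> z [bz Fzy lt_zy].
  exists z; first by rewrite GE Fzy.
  by rewrite (same_connect_r symFc (connect1 Fzy)) xy ltn_add2l ltnS.
Qed.

Lemma gdist_bridge_same x y :
  connect F a x -> connect F a y -> gdist G x y = gdist F x y.
Proof.
by move=> ax ay; rewrite gdist_bridge // -(same_connect symFc ax) ay.
Qed.

Lemma gdist_bridge_across x y : connect F a x -> connect F b y ->
  gdist G x y = gdist F x a + (gdist F b y).+1.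
Proof.
move=> ax yb; rewrite gdist_bridge // -(same_connect symFc ax).
by rewrite -(same_connect_r symFc yb) (negPf nab).
Qed.

End Bridge.

(** [G1] and [G2] are obtained from a graph [F] with two components by joining
    them with the edges [c d] and [a b].  This is one predicate because it is
    invariant under exchanging the two components. *)
Definition bridge_exchange (T : finType) (F G1 G2 : rel T) (a b c d : T) :=
  [/\ symmetric F /\ ~~ connect F c d,
      forall x y, G1 x y = F x y || ([set x; y] == [set c; d]),
      forall x y, G2 x y = F x y || ([set x; y] == [set a; b]),
      forall x, connect F c x || connect F d x &
      connect F c a /\ connect F d b].

Lemma bridge_exchange_swap (T : finType) (F G1 G2 : rel T) a b c d :
  bridge_exchange F G1 G2 a b c d -> bridge_exchange F G1 G2 b a d c.
Proof.
case=> [[symF ncd] G1E G2E Fcd [ca db]]; split=> // [|x y|x y|x].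
- by rewrite (sym_connect_sym symF).
- by rewrite G1E [[set d; c]]setUC.
- by rewrite G2E [[set b; a]]setUC.
- by rewrite orbC.
Qed.

(** In [G1] a vertex [s] beyond the bridge sees [x] and [y] through [c], which
    does not tell them apart; on the near side both graphs have the distances
    of [F]. *)
Lemma bridge_exchange_same (T : finType) (F G1 G2 : rel T) a b c d s x y :
    bridge_exchange F G1 G2 a b c d -> connect F c x -> connect F c y ->
    gdist G2 c x = gdist G2 c y -> gdist G2 s x = gdist G2 s y ->
  gdist G1 s x = gdist G1 s y.
Proof.
move=> ex cx cy.
have [[symF ncd] G1E G2E Fcd [ca db]] := ex.
have symFc := sym_connect_sym symF.
have nab : ~~ connect F a b.
  by rewrite -(same_connect symFc ca) -(same_connect_r symFc db).
have Fab z : connect F a z || connect F b z.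
  by rewrite -(same_connect symFc ca) -(same_connect symFc db).
have dist1 u v : connect F c u -> connect F c v -> gdist G1 u v = gdist F u v.
  exact: (gdist_bridge_same symF G1E).
have dist2 u v : connect F c u -> connect F c v -> gdist G2 u v = gdist F u v.
  by rewrite !(same_connect symFc ca); apply: (gdist_bridge_same symF G2E).
have [cs _ | ds] := orP (Fcd s); first by rewrite !dist1 // !dist2.
move=> cxy _; move: cxy; rewrite !dist2 ?connect0 // => cxy.
have [[_ ndc] G1E' _ Fdc _] := bridge_exchange_swap ex.
by rewrite !(gdist_bridge_across symF G1E' ndc Fdc) // cxy.
Qed.

(** In [G2] the vertex [c] reaches [y] only through [a], so [x] cannot be as
    close to [a] as [y] is to [b] when [c] is equidistant from both. *)
Lemma bridge_exchange_across (T : finType) (F G1 G2 : rel T) a b c d x y :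
    bridge_exchange F G1 G2 a b c d -> connect F c x -> connect F d y ->
    gdist G2 c x = gdist G2 c y ->
  gdist F b y < gdist F a x.
Proof.
case=> [[symF ncd] _ G2E Fcd [ca db]] cx dy.
have symFc := sym_connect_sym symF.
have nab : ~~ connect F a b.
  by rewrite -(same_connect symFc ca) -(same_connect_r symFc db).
have Fab z : connect F a z || connect F b z.
  by rewrite -(same_connect symFc ca) -(same_connect symFc db).
have ac : connect F a c by rewrite symFc.
have ax : connect F a x by rewrite -(same_connect symFc ca).
have biy : connect F b y by rewrite -(same_connect symFc db).
rewrite (gdist_bridge_same symF G2E) // (gdist_bridge_across symF G2E) //.
by move=> cxy; have := gdist_triangle ca ax; rewrite cxy leq_add2l.
Qed.

Lemma generator_bridge_exchange (T : finType) (F G1 G2 : rel T) a b c d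
    (S : {set T}) :
    bridge_exchange F G1 G2 a b c d -> metric_generator G1 S ->
  metric_generator G2 (c |: (d |: S)).
Proof.
move=> ex genS; have xe := bridge_exchange_swap ex.
apply/forallP=> x; apply/forallP=> y; apply/implyP=> nxy.
apply/contraT; rewrite negb_exists_in => /forall_inP unres.
have eq_dist v : v \in c |: (d |: S) -> gdist G2 v x = gdist G2 v y.
  by move/unres/negPn/eqP.
have cxy : gdist G2 c x = gdist G2 c y by rewrite eq_dist ?inE ?eqxx.
have dxy : gdist G2 d x = gdist G2 d y by rewrite eq_dist ?inE ?eqxx ?orbT.
have [s sS] : exists2 s, s \in S & gdist G1 s x != gdist G1 s y.
  by have /forallP/(_ x)/forallP/(_ y)/implyP/(_ nxy)/exists_inP := genS.
have sxy : gdist G2 s x = gdist G2 s y by rewrite eq_dist // !inE sS !orbT.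
have [_ _ _ Fcd _] := ex.
case/orP: (Fcd x) => Fx; case/orP: (Fcd y) => Fy.
- by rewrite (bridge_exchange_same ex Fx Fy cxy sxy) eqxx.
- have := ltn_trans (bridge_exchange_across ex Fx Fy cxy)
                    (bridge_exchange_across xe Fy Fx (esym dxy)).
  by rewrite ltnn.
- have := ltn_trans (bridge_exchange_across ex Fy Fx (esym cxy))
                    (bridge_exchange_across xe Fx Fy dxy).
  by rewrite ltnn.
- by rewrite (bridge_exchange_same xe Fx Fy dxy sxy) eqxx.
Qed.

(** * Edge exchanges between trees *)

(** A path from [c] to [d] in [F] would close up into a cycle with [c d]. *)
Lemma acyclic_bridge (T : finType) (e F : rel T) c d :
    symmetric e -> acyclic_graph e -> e c d -> c != d ->
    subrel F e -> ~~ F c d ->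
  ~~ connect F c d.
Proof.
move=> syme acye ecd ncd sFe nFcd; apply/negP => /connectP[p0 Fp0 lp0].
move: ncd nFcd ecd; rewrite lp0; case: (shortenP Fp0) => p Fp Up _ ncd nFcd ecd.
apply: (acye (c :: p)).
  case: p Fp ncd nFcd {Up ecd} => [|z [|]] //=; first by rewrite eqxx.
  by case/andP=> ->.
apply/andP; split=> //=.
by rewrite rcons_path (sub_path sFe Fp) /= syme.
Qed.

Lemma edge_exchange_sym (T : finType) (t1 t2 : rel T) :
  simple_graph t1 -> edge_exchange t1 t2 -> edge_exchange t2 t1.
Proof.
case=> sym1 irr1 [a [b [c [d [nab n1ab t1cd t2E]]]]].
have t1P x y : t1 x y -> ([set x; y] == [set a; b]) = false.
  move=> xy; apply: contraNF n1ab.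
  by rewrite eq_set2 => /orP[] /andP[/eqP<- /eqP<-] //; rewrite sym1.
exists c, d, a, b; split=> [|||x y].
- by apply: contraL t1cd => /eqP->; rewrite irr1.
- by rewrite t2E eqxx andbF.
- by rewrite t2E eqxx orbT eq_sym t1P.
rewrite t2E; have [xy|_] := eqVneq [set x; y] [set c; d]; last first.
  by rewrite orbF andbT; have [/t1P->|] := boolP (t1 x y); rewrite ?andbN.
have xy1 : t1 x y.
  move/eqP: xy; rewrite eq_set2 => /orP[] /andP[/eqP-> /eqP->] //.
  by rewrite sym1.
by rewrite xy1 t1P.
Qed.

Lemma connect_endpoint (T : finType) (G F : rel T) c d :
    (forall x y, G x y -> F x y || ([set x; y] == [set c; d])) ->
    (forall x, connect G c x) ->
  forall x, connect F c x || connect F d x.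
Proof.
move=> GF Gc x; have /connectP[p Gp ->] := Gc x.
have extend y q : connect F c y || connect F d y -> path G y q ->
    connect F c (last y q) || connect F d (last y q).
  elim: q y => //= z q IHq y Fy /andP[/GF/orP[Fyz|yz] Gq]; apply: IHq Gq.
    by case/orP: Fy => /connect_trans/(_ (connect1 Fyz))->; rewrite ?orbT.
  by move: yz; rewrite eq_set2 => /orP[] /andP[_ /eqP->]; rewrite connect0 ?orbT.
by apply: extend Gp; rewrite connect0.
Qed.

(** The common part of the two trees is [t1] without its edge [c d], which is
    also [t2] without its edge [a b]. *)
Lemma tree_bridge_exchange (T : finType) (t1 t2 : rel T) :
    tree t1 -> tree t2 -> edge_exchange t1 t2 ->
  exists F a b c d, bridge_exchange F t1 t2 a b c d.
Proof.
move=> [[sym1 irr1] [_ conn1] acy1] [[sym2 _] [_ _] acy2].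
case=> a [b [c [d [nab n1ab t1cd t2E]]]].
have ncd : c != d by apply: contraL t1cd => /eqP->; rewrite irr1.
pose F x y := t1 x y && ([set x; y] != [set c; d]).
have symF : symmetric F by move=> x y; rewrite /F sym1 [[set x; y]]setUC.
have symFc := sym_connect_sym symF.
have t1E x y : t1 x y = F x y || ([set x; y] == [set c; d]).
  rewrite /F; have [/eqP xy|_] := eqVneq; last by rewrite andbT orbF.
  move: xy; rewrite eq_set2 andbF => /orP[] /andP[/eqP-> /eqP->] //.
  by rewrite sym1.
have ab_cd : ([set a; b] == [set c; d]) = false.
  by apply: contraNF n1ab => ab; rewrite t1E ab orbT.
have t2F x y : t2 x y = F x y || ([set x; y] == [set a; b]).
  rewrite t2E /F; have [->|_] := eqVneq [set x; y] [set a; b].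
    by rewrite ab_cd orbT andbT orbT.
  by rewrite !orbF.
have nFcd : ~~ connect F c d.
  apply: (acyclic_bridge sym1 acy1 t1cd) => // [x y /andP[]//|].
  by rewrite /F eqxx andbF.
have nFab : ~~ connect F a b.
  apply: (acyclic_bridge sym2 acy2) => // [|x y|].
  - by rewrite t2F eqxx orbT.
  - by rewrite t2F => ->.
  - by rewrite /F (negPf n1ab).
have Fcd : forall x, connect F c x || connect F d x.
  by apply: connect_endpoint (conn1 c) => x y; rewrite t1E.
exists F; case/orP: (Fcd a) (Fcd b) => Fa /orP[] Fb.
- by case/negP: nFab; rewrite -(same_connect symFc Fa).
- by exists a, b, c, d.
- by exists b, a, c, d; split=> // x y; rewrite t2F [[set b; a]]setUC.
- by case/negP: nFab; rewrite -(same_connect symFc Fa).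
Qed.

Section MetricDim.

Variables (T : finType) (e : rel T).

Lemma metric_dim_le (S : {set T}) : metric_generator e S -> metric_dim e <= #|S|.
Proof.
rewrite /metric_dim; case: arg_minnP => [|M _]; last exact.
exact: metric_generatorT.
Qed.

Lemma exists_metric_basis : exists B : {set T}, metric_basis e B.
Proof.
exists [arg min_(S < [set: T] | metric_generator e S) #|S|].
rewrite /metric_basis eqxx andbT; case: arg_minnP => //.
exact: metric_generatorT.
Qed.

End MetricDim.

Lemma metric_dim_exchange (T : finType) (t1 t2 : rel T) :
    tree t1 -> tree t2 -> edge_exchange t1 t2 ->
  metric_dim t2 <= metric_dim t1 + 2 /\
  (metric_dim t2 = metric_dim t1 + 2 ->
   exists B1 B2 : {set T},
     [/\ metric_basis t1 B1, metric_basis t2 B2 & B1 \subset B2]).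
Proof.
move=> T1 T2 /(tree_bridge_exchange T1 T2)[F [a [b [c [d ex]]]]].
have [B basisB] := exists_metric_basis t1.
have /andP[genB /eqP cardB] := basisB.
have genB2 := generator_bridge_exchange ex genB.
have le_card : #|c |: (d |: B)| <= metric_dim t1 + 2.
  by rewrite !cardsU1 cardB addnA addnC leq_add2l -[2]/(1 + 1) leq_add ?leq_b1.
have le_dim := metric_dim_le genB2.
split=> [|dim2]; first exact: leq_trans le_dim le_card.
exists B, (c |: (d |: B)); split=> //; last by rewrite setUA subsetUr.
by rewrite /metric_basis genB2 eqn_leq le_dim dim2 le_card.
Qed.

(** * Two trees attaining the bounds *)

(** In a cycle of length at least three, a vertex of maximal rank would be
    joined to two distinct neighbours that are both its parent. *)
Lemma tree_of_parent (T : finType) (r : T) (p : T -> T) (rk : T -> nat)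
    (e : rel T) :
    (forall x y, e x y = (x != y) && ((y == p x) || (x == p y))) ->
    (forall x, x != r -> rk (p x) < rk x) ->
    p r = r ->
  tree e.
Proof.
move=> eE rk_lt pr.
have syme : symmetric e by move=> x y; rewrite !eE eq_sym orbC.
have e_parent x y : e x y -> rk y <= rk x -> y = p x.
  rewrite eE => /andP[nxy /orP[/eqP-> //|/eqP xE]].
  have [yr|/rk_lt] := eqVneq y r; first by rewrite xE yr pr eqxx in nxy.
  by rewrite -xE ltnNge => /negPf->.
have root x : connect e x r.
  have [n] := ubnP (rk x); elim: n x => // n IHn x lt_x.
  have [->|nxr] := eqVneq x r; first exact: connect0.
  have lt_p := rk_lt _ nxr.
  apply: connect_trans (connect1 _) (IHn (p x) (leq_trans lt_p lt_x)).
  by rewrite eE eqxx andbT; apply: contraTneq lt_p => <-; rewrite ltnn.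
split.
- by split=> // x; rewrite eE eqxx.
- split; first by apply/card_gt0P; exists r.
  by move=> x y; apply: connect_trans (root x) _; rewrite (sym_connect_sym syme).
move=> c lt2c /andP[cyc Uc].
have [x0 c0] : exists x, x \in c.
  by case: c lt2c {cyc Uc} => // x q; exists x; exact: mem_head.
case: (@arg_maxnP _ x0 (mem c) rk c0) => x cx max_x.
have nextx : next c x = p x.
  by apply: e_parent (next_cycle cyc cx) (max_x _ _); rewrite /= mem_next.
have prevx : prev c x = p x.
  apply: e_parent; first by rewrite syme; exact: prev_cycle.
  by apply: max_x; rewrite /= mem_prev.
have next2 : next c (next c x) = x by rewrite nextx -prevx next_prev.
have [i q Ei] := rot_to cx.
have: uniq (rot i c) by rewrite rot_uniq.
move: lt2c next2; rewrite -(size_rot i) -!(next_rot i Uc) Ei.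
case: q {Ei} => [|y [|z q]] //= _.
rewrite eqxx /= !inE !negb_or; case: eqVneq => //= nyx; rewrite eqxx => ->.
by rewrite eqxx.
Qed.

(** A fork is a hub adjacent to two leaves and to a port.  Both trees consist
    of two forks, told apart by a boolean. *)
Definition fork := option (option bool).
Definition hub : fork := None.
Definition port : fork := Some None.
Definition leaf (i : bool) : fork := Some (Some i).

Definition two_forks : finType := (bool * fork)%type.

Definition parent_ports (x : two_forks) : two_forks :=
  match x with
  | (true, _) => (true, hub)
  | (false, None) => (false, port)
  | (false, Some None) => (true, port)
  | (false, Some (Some _)) => (false, hub)
  end.

Definition parent_hubs (x : two_forks) : two_forks :=
  match x with
  | (true, _) | (false, None) => (true, hub)
  | (false, Some _) => (false, hub)
  end.

Definition joined_by_parent (p : two_forks -> two_forks) : rel two_forks :=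
  fun x y => (x != y) && ((y == p x) || (x == p y)).

Definition tree_ports := joined_by_parent parent_ports.
Definition tree_hubs := joined_by_parent parent_hubs.

Lemma tree_ports_tree : tree tree_ports.
Proof.
pose rk (x : two_forks) := match x with
  | (true, None) => 0 | (true, Some _) => 1
  | (false, Some None) => 2 | (false, None) => 3 | (false, Some _) => 4
  end.
by apply: (@tree_of_parent _ (true, hub) parent_ports rk) => // -[[] [[[]|]|]].
Qed.

Lemma tree_hubs_tree : tree tree_hubs.
Proof.
pose rk (x : two_forks) := match x with
  | (true, None) => 0 | (true, Some _) | (false, None) => 1
  | (false, Some _) => 2
  end.
by apply: (@tree_of_parent _ (true, hub) parent_hubs rk) => // -[[] [[[]|]|]].
Qed.

Lemma ports_hubs_exchange : edge_exchange tree_ports tree_hubs.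
Proof.
exists (true, hub), (false, hub), (true, port), (false, port); split=> // x y.
by rewrite !eq_set2; case: x y => [[] [[[]|]|]] [[] [[[]|]|]].
Qed.

(** The distances in [tree_ports] from one leaf of each fork, which form a
    metric generator. *)
Definition dist_leaf (s : bool) (x : two_forks) : nat :=
  let: (t, z) := x in
  match z with
  | None => if t == s then 1 else 4
  | Some None => if t == s then 2 else 3
  | Some (Some i) => if t == s then (if i then 0 else 2) else 5
  end.

Lemma gdist_leaf s x : gdist tree_ports (s, leaf true) x = dist_leaf s x.
Proof.
move: x; apply: gdist_unique => [x|x y|].
- by case: s x => [] [[] [[[]|]|]].
- by case: s x y => [] [[] [[[]|]|]] [[] [[[]|]|]].
(* Each vertex is preceded by the next vertex on its path to the leaf. *)
case=> t z f_gt0.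
exists (match z with
        | Some (Some _) => (t, hub)
        | Some None => if t == s then (t, hub) else (s, port)
        | None => if t == s then (t, leaf true) else (t, port)
        end); by case: s t z f_gt0 => [] [] [[[]|]|].
Qed.

Lemma metric_dim_ports : metric_dim tree_ports <= 2.
Proof.
rewrite -[2](_ : #|[set (true, leaf true); (false, leaf true) : two_forks]| = 2).
  apply: metric_dim_le; apply/forallP=> x; apply/forallP=> y; apply/implyP=> nxy.
  apply: contraT; rewrite negb_exists_in => /forall_inP unres.
  have eq_dist s : dist_leaf s x = dist_leaf s y.
    rewrite -!gdist_leaf; apply/eqP; rewrite -[_ == _]negbK unres //.
    by case: s; rewrite !inE eqxx ?orbT.
  move: nxy (eq_dist true) (eq_dist false).
  by case: x y {unres eq_dist} => [[] [[[]|]|]] [[] [[[]|]|]].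
by rewrite cards2.
Qed.

Lemma metric_dim_hubs : 4 <= metric_dim tree_hubs.
Proof.
have [S /andP[genS /eqP <-]] := exists_metric_basis tree_hubs.
(* Pendant vertices of the same hub are twins. *)
have twins s z1 z2 : z1 != z2 -> z1 != hub -> z2 != hub ->
    ((s, z1) \in S) || ((s, z2) \in S).
  move=> nz nz1 nz2; apply: generator_twins genS => [[t w]|].
    by move: s t w z1 z2 nz nz1 nz2 => [] [] [[[]|]|] [[[]|]|] [[[]|]|].
  by rewrite xpair_eqE eqxx.
have two s : exists z w, [/\ z != w, (s, z) \in S & (s, w) \in S].
  have [port_s | /negPf port_s] := boolP ((s, port) \in S).
    have [leaf_s | leaf_s] := orP (twins s (leaf true) (leaf false) isT isT isT).
      by exists port, (leaf true).
    by exists port, (leaf false).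
  exists (leaf true), (leaf false).
  have := twins s port (leaf true) isT isT isT.
  by have := twins s port (leaf false) isT isT isT; rewrite port_s /= => -> ->.
have [z [w [nzw zS wS]]] := two true; have [z' [w' [nzw' zS' wS']]] := two false.
pose s := [:: (true, z); (true, w); (false, z'); (false, w')] : seq two_forks.
have us : uniq s by rewrite /= !inE !xpair_eqE /= negb_or nzw nzw'.
rewrite -[4]/(size s) -(card_uniqP us); apply: subset_leq_card.
by apply/subsetP=> x; rewrite !inE => /or4P[] /eqP->.
Qed.

(* The bound dim(T1) - 2 is written with the 2 on the other side, as
   subtraction on nat is truncated. *)
Theorem theorem5p3 :
  (forall (T : finType) (t1 t2 : rel T),
     tree t1 -> tree t2 -> edge_exchange t1 t2 ->
     [/\ metric_dim t1 <= metric_dim t2 + 2,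
         metric_dim t2 <= metric_dim t1 + 2,
         metric_dim t2 = metric_dim t1 + 2 ->
           exists B1 B2 : {set T},
             [/\ metric_basis t1 B1, metric_basis t2 B2 & B1 \subset B2] &
         metric_dim t1 = metric_dim t2 + 2 ->
           exists B1 B2 : {set T},
             [/\ metric_basis t1 B1, metric_basis t2 B2 & B2 \subset B1]]) /\
  (exists (T : finType) (t1 t2 : rel T),
     [/\ tree t1, tree t2, edge_exchange t1 t2 &
         metric_dim t2 = metric_dim t1 + 2]) /\
  (exists (T : finType) (t1 t2 : rel T),
     [/\ tree t1, tree t2, edge_exchange t1 t2 &
         metric_dim t1 = metric_dim t2 + 2]).
Proof.
have dims : metric_dim tree_hubs = metric_dim tree_ports + 2.
  have [le_dim _] :=
    metric_dim_exchange tree_ports_tree tree_hubs_tree ports_hubs_exchange.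
  apply/eqP; rewrite eqn_leq le_dim /=.
  by apply: leq_trans metric_dim_hubs; rewrite addn2 !ltnS metric_dim_ports.
have sgports : simple_graph tree_ports by case: tree_ports_tree.
split; last split.
- move=> T t1 t2 T1 T2 ex; have [simple1 _ _] := T1.
  have [le21 eq21] := metric_dim_exchange T1 T2 ex.
  have [le12 eq12] := metric_dim_exchange T2 T1 (edge_exchange_sym simple1 ex).
  split=> // /eq12[B2 [B1 [basis2 basis1 sB21]]].
  by exists B1, B2.
- exists two_forks, tree_ports, tree_hubs; split=> //.
  + exact: tree_ports_tree.
  + exact: tree_hubs_tree.
  + exact: ports_hubs_exchange.
- exists two_forks, tree_hubs, tree_ports; split=> //.
  + exact: tree_hubs_tree.
  + exact: tree_ports_tree.
  + exact: edge_exchange_sym sgports ports_hubs_exchange.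
Qed.
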